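(* Let $n\ge 1$ and $\varepsilon>0$. Define $$\rho_\varepsilon(h):=\frac{2\sqrt{\varepsilon^2-|h|^2}}{|B_\varepsilon^{n+1}|},\qquad h\in B_\varepsilon(0)\subset\mathbb{R}^n.$$ Then $\rho_\varepsilon$ is a strictly positive probability density on $B_\varepsilon(0)$ (with respect to Lebesgue measure on $\mathbb{R}^n$).
   Context: $B_\varepsilon(0)\subset\mathbb{R}^n$ is the open Euclidean ball of radius $\varepsilon$ centered at $0$, and $|B_\varepsilon^{n+1}|$ is the $(n+1)$-dimensional Lebesgue measure of a Euclidean ball of radius $\varepsilon$ in $\mathbb{R}^{n+1}$. *)

(* Defs.v *)
From HB Require Import structures.
From mathcomp Require Import all_boot all_order all_algebra.
From mathcomp Require Import all_classical all_reals all_analysis.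

Set Implicit Arguments.
Unset Strict Implicit.
Unset Printing Implicit Defensive.

Import Order.TTheory GRing.Theory Num.Theory.
Import numFieldNormedType.Exports.
Local Open Scope classical_set_scope.
Local Open Scope ring_scope.

(* The sigma-algebra of [n.-tuple] is the one generated by the coordinate maps;
   with Borel coordinates it is the Borel sigma-algebra of R^n. *)
Notation euclidean R n := (n.-tuple (measurableTypeR R)).

Definition enorm {R : realType} {n : nat} (x : n.-tuple R) : R :=
  Num.sqrt (\sum_(i < n) tnth x i ^+ 2).

Definition eball {R : realType} (n : nat) (e : R) : set (euclidean R n) :=
  [set x | enorm x < e].
Arguments eball {R} n e.

Definition euclidean_cons {R : realType} {n : nat}
  (p : measurableTypeR R * euclidean R n) : euclidean R n.+1 :=
  [tuple of p.1 :: p.2].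

Lemma measurable_euclidean_cons {R : realType} {n : nat} :
  measurable_fun [set: measurableTypeR R * euclidean R n] euclidean_cons.
Proof. exact: measurable_cons. Qed.

(* R^0 is a point of mass 1, and R^n.+1 is identified with R * R^n. *)
Fixpoint lebesgue_measure_n (R : realType) (n : nat) :
    set (euclidean R n) -> \bar R :=
  match n with
  | 0 => \d_([tuple] : euclidean R 0)
  | n'.+1 =>
      pushforward (lebesgue_measure \x @lebesgue_measure_n R n')%E euclidean_cons
  end.
Arguments lebesgue_measure_n {R} n.

Section sigma_finite_measureE.
Context d (T : measurableType d) (R : realType).
Variable m : {measure set T -> \bar R}.

Definition sigma_finite_copy & sigma_finite setT m : set T -> \bar R := m.

Variable sm : sigma_finite setT m.

HB.instance Definition _ := Measure.copy (sigma_finite_copy sm) m.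
HB.instance Definition _ :=
  Measure_isSigmaFinite.Build _ _ _ (sigma_finite_copy sm) sm.

Lemma sigma_finite_measureE :
  exists m0 : {sigma_finite_measure set T -> \bar R},
    m = m0 :> (set T -> \bar R).
Proof. by exists (sigma_finite_copy sm). Qed.

End sigma_finite_measureE.

Section lebesgue_measure_n_structure.
Context {R : realType}.

Let uncons n (x : euclidean R n.+1) : measurableTypeR R * euclidean R n :=
  (thead x, [tuple of behead x]).

Let consK n : cancel (@euclidean_cons R n) (@uncons n).
Proof. by case=> a t; congr pair; exact/val_inj. Qed.

Let measurable_uncons n : measurable_fun setT (@uncons n).
Proof.
apply/measurable_fun_pairP; split; last exact: measurable_behead.
exact: measurable_tnth.
Qed.

Let sigma_finite_measure_exists n :
  exists m : {sigma_finite_measure set (euclidean R n) -> \bar R},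
    lebesgue_measure_n n = m.
Proof.
elim: n => [|n [m mE]] /=; first by exists \d_([tuple] : euclidean R 0).
rewrite mE {mE}; pose l : {measure set (measurableTypeR R * euclidean R n)%type -> \bar R} :=
  (@lebesgue_measure R \x m)%E.
have sl : sigma_finite setT l.
  have /sigma_finiteP[F [FT ndF Foo]] := sigma_finiteT (@lebesgue_measure R).
  have /sigma_finiteP[G [GT ndG Goo]] := sigma_finiteT m.
  exists (fun i => F i `*` G i).
    apply/seteqP; split => // -[x y] _.
    have [i _ Fx] : (\bigcup_i F i) x by rewrite -FT.
    have [j _ Gy] : (\bigcup_j G j) y by rewrite -GT.
    exists (maxn i j) => //; split.
      by move: x Fx; exact/subsetPset/ndF/leq_maxl.
    by move: y Gy; exact/subsetPset/ndG/leq_maxr.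
  move=> i; have [mF Fi] := Foo i; have [mG Gi] := Goo i.
  split; first exact: measurableX.
  by rewrite /l /= product_measure1E// lte_mul_pinfty// ge0_fin_numE.
have mf : measurable_fun setT (@euclidean_cons R n).
  exact: measurable_euclidean_cons.
pose p : {measure set (euclidean R n.+1) -> \bar R} :=
  measure_function_pushforward__canonical__measure_function_Measure l mf.
have sp : sigma_finite setT p.
  have [F FT Foo] := sl.
  exists (fun i => @uncons n @^-1` F i).
    by rewrite -preimage_bigcup -FT preimage_setT.
  move=> i; have [mF Fi] := Foo i; split.
    by rewrite -[X in measurable X]setTI; exact: measurable_uncons.
  rewrite /p /= /pushforward (_ : _ @^-1` _ = F i)//.
  by apply/seteqP; split => x /=; rewrite consK.
exact: sigma_finite_measureE sp.
Qed.

Let lebesgue_measure_n0 n : lebesgue_measure_n n (@set0 (euclidean R n)) = 0%E.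
Proof. by have [m ->] := sigma_finite_measure_exists n. Qed.

Let lebesgue_measure_n_ge0 n (A : set (euclidean R n)) :
  (0 <= lebesgue_measure_n n A)%E.
Proof. by have [m ->] := sigma_finite_measure_exists n. Qed.

Let lebesgue_measure_n_sigma_additive n :
  semi_sigma_additive (@lebesgue_measure_n R n).
Proof.
have [m ->] := sigma_finite_measure_exists n.
exact: measure_semi_sigma_additive.
Qed.

HB.instance Definition _ n := isMeasure.Build _ _ _ (@lebesgue_measure_n R n)
  (lebesgue_measure_n0 n) (@lebesgue_measure_n_ge0 n)
  (@lebesgue_measure_n_sigma_additive n).

Let lebesgue_measure_n_sigma_finite n :
  sigma_finite setT (@lebesgue_measure_n R n).
Proof.
by have [m ->] := sigma_finite_measure_exists n; exact: sigma_finiteT.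
Qed.

HB.instance Definition _ n := Measure_isSigmaFinite.Build _ _ _
  (@lebesgue_measure_n R n) (@lebesgue_measure_n_sigma_finite n).

End lebesgue_measure_n_structure.

Lemma lebesgue_measure_n_box {R : realType} (n : nat)
    (A : 'I_n -> set (measurableTypeR R)) :
  (forall i, measurable (A i)) ->
  lebesgue_measure_n n [set x | forall i, A i (tnth x i)] =
    (\prod_(i < n) lebesgue_measure (A i))%E.
Proof.
elim: n A => [|n IH] A mA /=.
  rewrite big_ord0 diracE mem_set//= => -[]//.
rewrite big_ord_recl -IH// -product_measure1E//; last first.
  rewrite [X in measurable X](_ : _ =
      \bigcap_(i in [set: 'I_n]) ((@tnth _ _ ^~ i) @^-1` A (lift ord0 i))).
    apply: fin_bigcap_measurable => // i _; rewrite -[X in measurable X]setTI.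
    exact: measurable_tnth.
  by apply/seteqP; split => x Hx i; [move=> _|]; exact: Hx.
congr ((_ \x _)%E _).
apply/seteqP; split => -[a t] /=.
  move=> H; split; first exact: (H ord0).
  by move=> i; have := H (lift ord0 i); rewrite tnthS.
move=> [Aa At] i; case: (unliftP ord0 i) => [j ->|->//].
by rewrite tnthS.
Qed.

(* [measurable D] is required explicitly because [measurable_fun D f] holds
   trivially when D is not measurable. *)
Definition probability_density d (T : measurableType d) (R : realType)
    (mu : {measure set T -> \bar R}) (D : set T) (f : T -> R) : Prop :=
  [/\ measurable D, measurable_fun D f, {in D, forall x, 0 <= f x} &
      (\int[mu]_(x in D) (f x)%:E = 1)%E].

(* [fine] sends +oo to 0; the volume below is in fact a positive real when
   0 < e. *)
Definition rho {R : realType} {n : nat} (e : R) (h : euclidean R n) : R :=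
  2 * Num.sqrt (e ^+ 2 - enorm h ^+ 2) /
  fine (lebesgue_measure_n n.+1 (eball n.+1 e)).

(* Main.v *)
(* The fibre of the (n+1)-dimensional ball over h is an open interval of length
   2 sqrt(e^2 - |h|^2), so by Fubini the numerator of rho integrates to the
   volume of that ball.  Normalising by this volume is legitimate because the
   ball lies between two open cubes centred at 0. *)
Require Import Defs.
From mathcomp Require Import all_boot all_order all_algebra.
From mathcomp Require Import all_classical all_reals all_analysis.
From mathcomp Require Import measurable_realfun lra.

Set Implicit Arguments.
Unset Strict Implicit.
Unset Printing Implicit Defensive.

Import Order.TTheory GRing.Theory Num.Theory.
Import numFieldNormedType.Exports.
Local Open Scope classical_set_scope.
Local Open Scope ring_scope.

Lemma enorm_ge0 (R : realType) (n : nat) (x : n.-tuple R) : 0 <= enorm x.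
Proof. exact: sqrtr_ge0. Qed.

Lemma sqr_enorm (R : realType) (n : nat) (x : n.-tuple R) :
  enorm x ^+ 2 = \sum_(i < n) tnth x i ^+ 2.
Proof. by rewrite sqr_sqrtr// sumr_ge0// => i _; exact: sqr_ge0. Qed.

Lemma sqr_enorm_cons (R : realType) (n : nat) (a : R) (x : n.-tuple R) :
  enorm [tuple of a :: x] ^+ 2 = a ^+ 2 + enorm x ^+ 2.
Proof.
rewrite !sqr_enorm big_ord_recl; congr (_ + _).
by apply: eq_bigr => i _; rewrite tnthS.
Qed.

(** Puts ball membership in squared form, where [sqr_enorm] and [sqr_enorm_cons] reduce it to an
    inequality between sums of squares. *)
Lemma enorm_lt (R : realType) (n : nat) (e : R) (x : n.-tuple R) :
  0 <= e -> (enorm x < e) = (enorm x ^+ 2 < e ^+ 2).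
Proof. by move=> e0; rewrite ltr_sqr// nnegrE enorm_ge0. Qed.

Lemma tnth_le_enorm (R : realType) (n : nat) (x : n.-tuple R) (i : 'I_n) :
  `|tnth x i| <= enorm x.
Proof.
rewrite -ler_sqr ?nnegrE ?enorm_ge0// sqr_enorm (bigD1 i)//= real_normK ?num_real//.
by rewrite lerDl sumr_ge0// => j _; exact: sqr_ge0.
Qed.

Lemma measurable_enorm (R : realType) (n : nat) :
  measurable_fun [set: euclidean R n] (@enorm R n).
Proof.
apply: (measurableT_comp (f := @Num.sqrt R)).
  exact: (continuous_measurable_fun (@sqrt_continuous R)).
by apply: measurable_sum => i; apply: measurable_funX; exact: measurable_tnth.
Qed.

Lemma measurable_eball (R : realType) (n : nat) (e : R) :
  measurable (eball n e).
Proof.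
rewrite [X in measurable X](_ : _ = @enorm R n @^-1` [set` `]-oo, e[]).
  rewrite -[X in measurable X]setTI; exact: measurable_enorm.
by apply/seteqP; split => x; rewrite /= in_itv.
Qed.

Definition cube (R : realType) (n : nat) (r : R) : set (euclidean R n) :=
  [set x | forall i, [set` `]-r, r[] (tnth x i)].
Arguments cube {R} n r.

Lemma lebesgue_measure_cube (R : realType) (n : nat) (r : R) : 0 <= r ->
  lebesgue_measure_n n (cube n r) = ((2 * r) ^+ n)%:E.
Proof.
move=> r0; rewrite /cube (@lebesgue_measure_n_box R n (fun=> [set` `]-r, r[]))//.
rewrite (eq_bigr (fun=> (2 * r)%:E)) => [|i _].
  by rewrite prodEFin prodr_const card_ord.
rewrite lebesgue_measure_itv/= lte_fin; case: ltP => [_|].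
  by rewrite opprK mulr_natl.
(* The interval is empty here; together with [0 <= r] this forces [r = 0], so both sides vanish. *)
by move=> rr; have -> : r = 0; [lra|rewrite mulr0].
Qed.

Lemma measurable_cube (R : realType) (n : nat) (r : R) :
  measurable (cube n r).
Proof.
rewrite [X in measurable X](_ : _ =
    \bigcap_(i in [set: 'I_n]) ((@tnth _ _ ^~ i) @^-1` [set` `]-r, r[])).
  apply: fin_bigcap_measurable => // i _; rewrite -[X in measurable X]setTI.
  exact: measurable_tnth.
by apply/seteqP; split => x Hx i; [move=> _|]; exact: Hx.
Qed.

Lemma eball_subset_cube (R : realType) (n : nat) (e : R) :
  eball n e `<=` cube n e.
Proof.
move=> x xe i /=; rewrite in_itv/= -ltr_norml.
exact: le_lt_trans (tnth_le_enorm x i) xe.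
Qed.

(** The squares of the [n.+1] coordinates add up to less than e^2/(n+1), which is at most e^2. The
    half-side e/(n+1) is below the sharp value e/sqrt(n+1) and keeps the computation free of
    roots. *)
Lemma cube_subset_eball (R : realType) (n : nat) (e : R) : 0 < e ->
  cube n.+1 (e / n.+1%:R) `<=` eball n.+1 e.
Proof.
move=> e0 x xe; rewrite /eball/= enorm_lt ?ltW// sqr_enorm.
have n0 : (0 : R) < n.+1%:R by [].
apply: (@lt_le_trans _ _ (\sum_(i < n.+1) (e / n.+1%:R) ^+ 2)).
  (* Summing strict bounds gives a strict bound only over a nonempty index set; [ord0] is the
     witness. *)
  apply: ltr_sum => [|i _]; first by apply/hasP; exists ord0; rewrite ?mem_index_enum.
  have := xe i; rewrite /= in_itv/= -ltr_norml => xi.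
  by rewrite -[X in X < _]real_normK ?num_real// ltr_sqr ?nnegrE ?divr_ge0// ltW.
rewrite sumr_const card_ord -[leLHS]mulr_natr exprMn -mulrA.
rewrite ler_piMr ?sqr_ge0// exprVn mulrC ler_pdivrMr ?exprn_gt0// mul1r.
by rewrite expr2 ler_peMl// ler1n.
Qed.

Lemma lebesgue_measure_eball_lty (R : realType) (n : nat) (e : R) : 0 <= e ->
  (lebesgue_measure_n n (eball n e) < +oo)%E.
Proof.
move=> e0; apply: (@le_lt_trans _ _ (lebesgue_measure_n n (cube n e))).
  apply: le_measure (@eball_subset_cube R n e); rewrite inE;
    [exact: measurable_eball|exact: measurable_cube].
by rewrite lebesgue_measure_cube// ltry.
Qed.

Lemma lebesgue_measure_eball_gt0 (R : realType) (n : nat) (e : R) : 0 < e ->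
  (0 < lebesgue_measure_n n.+1 (eball n.+1 e))%E.
Proof.
move=> e0; pose r := e / n.+1%:R; have r0 : 0 < r by rewrite divr_gt0.
apply: (@lt_le_trans _ _ (lebesgue_measure_n n.+1 (cube n.+1 r))).
  by rewrite lebesgue_measure_cube ?ltW// lte_fin exprn_gt0// mulr_gt0.
apply: le_measure (cube_subset_eball e0); rewrite inE;
  [exact: measurable_cube|exact: measurable_eball].
Qed.

(** Membership of [a] means a^2 < e^2 - |h|^2, that is, |a| is below the root. When |h| >= e the
    fibre is empty and [Num.sqrt] of a nonpositive number is 0, so the formula covers every [h]. *)
Lemma lebesgue_measure_eball_fibre (R : realType) (n : nat) (e : R)
    (h : n.-tuple R) : 0 <= e ->
  lebesgue_measure [set a : R | enorm [tuple of a :: h] < e] =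
  (2 * Num.sqrt (e ^+ 2 - enorm h ^+ 2))%:E.
Proof.
move=> e0; set s := Num.sqrt _; have s0 : 0 <= s := sqrtr_ge0 _.
rewrite (_ : [set _ | _] = [set` `]-s, s[]).
  rewrite lebesgue_measure_itv/= lte_fin; case: ltP => [_|ss].
    by rewrite opprK mulr_natl.
  by have -> : s = 0; [lra|rewrite mulr0].
apply/seteqP; split => a /=;
  rewrite enorm_lt// sqr_enorm_cons in_itv/= -ltr_norml -sqrtr_sqr -ltrBrDr.
  move=> ah; rewrite ltr_sqrt//; exact: le_lt_trans (sqr_ge0 a) ah.
(* If the radicand is nonpositive then [s] is 0, and no |a| lies strictly below it. *)
have [p|p] := ltP 0 (e ^+ 2 - enorm h ^+ 2); first by rewrite ltr_sqrt.
by rewrite /s (ler0_sqrtr p) ltNge sqrtr_ge0.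
Qed.

Lemma lebesgue_measure_eballS (R : realType) (n : nat) (e : R) : 0 < e ->
  lebesgue_measure_n n.+1 (eball n.+1 e) =
  (\int[lebesgue_measure_n n]_(h in eball n e)
     (2 * Num.sqrt (e ^+ 2 - enorm h ^+ 2))%:E)%E.
Proof.
move=> e0; rewrite /= /pushforward.
set A := euclidean_cons @^-1` _.
have mA : measurable A.
  rewrite -[A]setTI; apply: measurable_euclidean_cons => //.
  exact: measurable_eball.
(* [\x] integrates over the first coordinate the measures of slices in R^n, while [\x^] integrates
   over [h] the lengths of the fibres. They agree on measurable rectangles, hence everywhere by
   uniqueness of the product measure. *)
transitivity ((lebesgue_measure \x^ lebesgue_measure_n n)%E A).
  by apply: product_measure_unique => // B C mB mC/=; rewrite product_measure2E.
rewrite /product_measure2 [RHS]integral_mkcond; apply: eq_integral => h _ /=.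
rewrite ysectionE (lebesgue_measure_eball_fibre _ (ltW e0)) patchE.
(* Outside the ball the restricted integrand is 0, and so is the fibre length, its radicand being
   nonpositive. *)
case: ifPn => // /negP; rewrite in_setE /eball/= => /negP.
rewrite enorm_lt ?ltW// -leNgt -subr_le0 => /ler0_sqrtr ->.
by rewrite mulr0.
Qed.

Theorem lemma2p4 (R : realType) (n : nat) (e : R) (n_ge1 : (1 <= n)%N)
    (e_gt0 : 0 < e) :
  (forall h : euclidean R n, eball n e h -> 0 < rho e h) /\
  probability_density (lebesgue_measure_n n) (eball n e) (rho e).
Proof.
pose V := lebesgue_measure_n n.+1 (eball n.+1 e).
have V0 : (0 < V)%E := lebesgue_measure_eball_gt0 n e_gt0.
(* Finiteness lets [fineK] identify [fine V] with [V] when the normalising factor is cancelled at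
   the end. *)
have Vfin : V \is a fin_num.
  rewrite ge0_fin_numE; last exact: ltW.
  by apply: lebesgue_measure_eball_lty; exact: ltW.
have fV0 : 0 < fine V by rewrite fine_gt0// V0 -ge0_fin_numE// ltW.
have rho_gt0 (h : euclidean R n) : eball n e h -> 0 < rho e h.
  rewrite /eball/= enorm_lt ?ltW// -subr_gt0 => hp.
  by rewrite /rho divr_gt0// mulr_gt0// sqrtr_gt0.
(* [Num.sqrt] is continuous on the whole line, being 0 on negatives, so measurability can be shown
   on all of R^n and then restricted to the ball. *)
have mf : measurable_fun [set: euclidean R n]
    (fun h : euclidean R n => 2 * Num.sqrt (e ^+ 2 - enorm h ^+ 2)).
  apply: measurable_funM => //.
  apply: (measurableT_comp (f := @Num.sqrt R)).
    exact: (continuous_measurable_fun (@sqrt_continuous R)).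
  apply: measurable_funB => //; apply: measurable_funX; exact: measurable_enorm.
split => //; split.
- exact: measurable_eball.
- by apply: measurable_funTS; apply: measurable_funM.
- by move=> h; rewrite inE => /rho_gt0/ltW.
- rewrite (eq_integral (fun h : euclidean R n =>
      (fine V)^-1%:E * (2 * Num.sqrt (e ^+ 2 - enorm h ^+ 2))%:E)%E); last first.
    by move=> h _; rewrite /rho -/V mulrC EFinM.
  rewrite ge0_integralZl_EFin//.
  + rewrite -lebesgue_measure_eballS// -/V -[X in (_ * X)%E](fineK Vfin) -EFinM.
    by rewrite mulVf// gt_eqF.
  + exact: measurable_eball.
  + by apply/measurable_EFinP; exact: measurable_funTS.
  + by rewrite invr_ge0 ltW.
Qed.
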